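(* Let $R$ be an associative ring with identity, let $\mathcal{X}$ and $\mathcal{Y}$ be two precovering classes of left $R$-modules, each closed under isomorphisms, finite direct sums and direct summands, such that $\mathcal{X}\subseteq\mathcal{Y}$, and let $M$ be a left $R$-module. Then $\mathcal{X}^{-1}(M)\subseteq\mathcal{Y}^{-1}(M)$. Furthermore, $\mathcal{X}^{-1}(M)=\mathcal{Y}^{-1}(M)$ if and only if $\mathcal{Y}\subseteq\mathcal{X}^{-1}(M)$.
   Context: Modules are unital left $R$-modules. For a class $\mathcal{X}$ of modules, an $\mathcal{X}$-precover of $N$ is a morphism $g:X\to N$ with $X\in\mathcal{X}$ such that $\mathrm{Hom}(X',X)\to\mathrm{Hom}(X',N)$ is surjective for every $X'\in\mathcal{X}$; $\mathcal{X}$ is precovering if every module has an $\mathcal{X}$-precover. The $\mathcal{X}$-precover completing domain $\mathcal{X}^{-1}(M)$ of a module $M$ is the class of all modules $N$ such that for every morphism $f:M\to N$ and every $\mathcal{X}$-precover $g:X\to N$ there is a morphism $h:M\to X$ with $gh=f$. $\mathcal{Y}^{-1}(M)$ is defined in the same way with $\mathcal{Y}$ in place of $\mathcal{X}$. *)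

(* Defs.v *)
From HB Require Import structures.
From mathcomp Require Import all_boot all_algebra.

Set Implicit Arguments.
Unset Strict Implicit.
Unset Printing Implicit Defensive.

Import GRing.Theory.
Local Open Scope ring_scope.

(* [pzRingType] is the structure of associative unital rings, the zero ring
   included; an [lmodType R] is a unital left R-module.  Classes of modules are
   Prop-valued predicates compared extensionally; MathComp-Analysis' [set] is
   not applicable to [lmodType R] (universe inconsistency). *)

Definition lmod_class (R : pzRingType) := lmodType R -> Prop.

Definition subclass (R : pzRingType) (X Y : lmod_class R) : Prop :=
  forall N : lmodType R, X N -> Y N.

Definition eqclass (R : pzRingType) (X Y : lmod_class R) : Prop :=
  forall N : lmodType R, X N <-> Y N.

Definition lmod_isomorphic (R : pzRingType) (U V : lmodType R) : Prop :=
  exists f : {linear U -> V}, bijective f.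

(* D is the direct sum of (N i)_(i < n) along the maps iota i: each element of
   D is a sum of elements iota i (y i) for a unique family y (n = 0: D = 0). *)
Definition is_direct_sum (R : pzRingType) (n : nat) (N : 'I_n -> lmodType R)
    (D : lmodType R) (iota : forall i, {linear N i -> D}) : Prop :=
  forall x : D, exists! y : {dffun forall i, N i}, x = \sum_i iota i (y i).

Definition is_direct_summand (R : pzRingType) (A B : lmodType R) : Prop :=
  exists C : lmodType R, lmod_isomorphic (A * C)%type B.

Definition closed_iso (R : pzRingType) (X : lmod_class R) : Prop :=
  forall U V : lmodType R, lmod_isomorphic U V -> X U -> X V.

Definition closed_finite_direct_sums (R : pzRingType) (X : lmod_class R) :
    Prop :=
  forall (n : nat) (N : 'I_n -> lmodType R) (D : lmodType R)
    (iota : forall i, {linear N i -> D}),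
    is_direct_sum iota -> (forall i, X (N i)) -> X D.

Definition closed_direct_summands (R : pzRingType) (X : lmod_class R) :
    Prop :=
  forall A B : lmodType R, is_direct_summand A B -> X B -> X A.

Definition is_precover (R : pzRingType) (X : lmod_class R)
    (U N : lmodType R) (g : {linear U -> N}) : Prop :=
  X U /\
  forall U' : lmodType R, X U' ->
  forall f : {linear U' -> N}, exists h : {linear U' -> U}, g \o h =1 f.

Definition precovering (R : pzRingType) (X : lmod_class R) : Prop :=
  forall N : lmodType R,
  exists (U : lmodType R) (g : {linear U -> N}), is_precover X g.

Definition precover_completing_domain (R : pzRingType) (X : lmod_class R)
    (M : lmodType R) : lmod_class R :=
  fun N => forall (f : {linear M -> N}) (U : lmodType R) (g : {linear U -> N}),
    is_precover X g -> exists h : {linear M -> U}, g \o h =1 f.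

(* Main.v *)
Require Import Defs.
From HB Require Import structures.
From mathcomp Require Import all_boot all_algebra.

Local Open Scope ring_scope.

Lemma precover_completing_domain_mono (R : pzRingType) (X Y : lmod_class R)
    (M : lmodType R) :
  precovering X -> subclass X Y ->
  subclass (precover_completing_domain X M) (precover_completing_domain Y M).
Proof.
move=> Xpre XY N XN f U g [_ gY].
have [V [p pP]] := Xpre N.
have [h ph] := XN f V p pP.
have [k gk] := gY V (XY V pP.1) p.
by exists (k \o h) => x; have:= gk (h x) => /= ->; apply: ph.
Qed.

Lemma subclass_precover_completing_domain (R : pzRingType) (Y : lmod_class R)
    (M : lmodType R) :
  subclass Y (precover_completing_domain Y M).
Proof.
move=> N YN f U g [_ gY].
have [s gs] := gY N YN idfun.
by exists (s \o f) => x; apply: gs.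
Qed.

(* Lift f through a Y-precover p : W -> N, then lift the result through an
   X-precover q : V -> W; the composite p \o q factors through g. *)
Lemma precover_completing_domain_anti (R : pzRingType) (X Y : lmod_class R)
    (M : lmodType R) :
  precovering X -> precovering Y ->
  subclass Y (precover_completing_domain X M) ->
  subclass (precover_completing_domain Y M) (precover_completing_domain X M).
Proof.
move=> Xpre Ypre YX N YN f U g [_ gX].
have [W [p pP]] := Ypre N.
have [h ph] := YN f W p pP.
have [V [q qP]] := Xpre W.
have [k qk] := YX W pP.1 h V q qP.
have [l gl] := gX V qP.1 (p \o q).
exists (l \o k) => x; have /= -> := gl (k x).
by have /= -> := qk x; apply: ph.
Qed.

Theorem proposition2p10 (R : pzRingType) (X Y : lmod_class R)
    (X_precovering : precovering X) (Y_precovering : precovering Y)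
    (X_iso : closed_iso X) (Y_iso : closed_iso Y)
    (X_sums : closed_finite_direct_sums X)
    (Y_sums : closed_finite_direct_sums Y)
    (X_summands : closed_direct_summands X)
    (Y_summands : closed_direct_summands Y)
    (XY : subclass X Y) (M : lmodType R) :
  subclass (precover_completing_domain X M) (precover_completing_domain Y M) /\
  (eqclass (precover_completing_domain X M) (precover_completing_domain Y M) <->
   subclass Y (precover_completing_domain X M)).
Proof.
split; first exact: precover_completing_domain_mono.
split=> [eqXY N YN | YX N].
  by apply/eqXY; apply: subclass_precover_completing_domain.
by split; [apply: precover_completing_domain_mono
          | apply: precover_completing_domain_anti].
Qed.
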